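(* Let $1<r<\infty$ and $q>0$. Let $M$ be a random variable with values in $[0,1]$ whose distribution is equivalent at $1$ to the distribution $\nu$ on $(0,1)$ whose density is proportional to $$t^{1/(r-1)}\exp\left(-\frac{1}{(1-t^{r/(r-1)})^{r-1}}\right),\qquad 0<t<1.$$ Let $R\stackrel{d}{=}\sum_{j=1}^\infty q\prod_{k=1}^{j-1}M_k$, where $M_1,M_2,\dots$ are i.i.d. copies of $M$. Then there are constants $c_1,c_2$ such that $$-\infty<c_1\le\liminf_{x\to\infty}\frac{\ln \mathbb{P}(R\ge x)}{(x/q)^r}\le\limsup_{x\to\infty}\frac{\ln \mathbb{P}(R\ge x)}{(x/q)^r}\le c_2<0.$$
   Context: Equivalence at 1: for probability distributions $\mu,\nu$ on $[0,1]$ and $\delta\in(0,1)$ put $\mu_\delta=\mu((1-\delta,1])$ and $\nu_\delta=\nu((1-\delta,1])$. The distributions $\mu$ and $\nu$ are equivalent at $1$ if there exist $\varepsilon>0$ and $0<d<D<\infty$ such that $d\le \mu_\delta/\nu_\delta\le D$ for all $\delta\in(0,\varepsilon]$. The empty product (for $j=1$) equals $1$. The random variable $R$ (a perpetuity) satisfies $R\stackrel{d}{=}q+MR$ with $M$ independent of $R$ on the right-hand side. *)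

(* Defs.v *)
From HB Require Import structures.
From mathcomp Require Import all_boot all_order all_algebra.
From mathcomp Require Import all_classical all_reals all_analysis.
From mathcomp Require Import measurable_realfun.

Set Implicit Arguments.
Unset Strict Implicit.
Unset Printing Implicit Defensive.

Import Order.TTheory GRing.Theory Num.Theory.
Import numFieldNormedType.Exports.

Local Open Scope classical_set_scope.
Local Open Scope ring_scope.
Local Open Scope ereal_scope.

(* The variables may live on different probability spaces. *)
Definition equal_in_law (R : realType) (d d1 d2 : measure_display)
    (U : measurableType d) (T1 : measurableType d1) (P1 : probability T1 R)
    (X1 : T1 -> U) (T2 : measurableType d2) (P2 : probability T2 R)
    (X2 : T2 -> U) : Prop :=
  forall A : set U, measurable A ->
    pushforward P1 X1 A = pushforward P2 X2 A.

Definition mutually_independent (R : realType) (d d1 : measure_display)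
    (U : measurableType d) (T : measurableType d1) (P : probability T R)
    (X : nat -> {RV P >-> U}) : Prop :=
  forall (s : seq nat) (A : nat -> set U), uniq s ->
    (forall k, measurable (A k)) ->
    P (\bigcap_(k in [set` s]) (X k @^-1` A k)) =
      \prod_(k <- s) P (X k @^-1` A k).

(* In \bar R, x / 0 is never in ]0, +oo[ for x >= 0 finite, so the bounds below
   force nu `]1 - delta, 1] to be nonzero. *)
Definition equivalent_at_1 (R : realType) (mu nu : set R -> \bar R) : Prop :=
  exists eps d D : R, [/\ (0 < eps < 1)%R, (0 < d < D)%R &
    forall delta : R, (0 < delta <= eps)%R ->
      let I := `](1 - delta)%R, 1%R]%classic in
      d%:E <= mu I / nu I <= D%:E].

Definition has_density_proportional_to (R : realType)
    (nu : set R -> \bar R) (f : R -> R) : Prop :=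
  exists2 c : R, (0 < c)%R &
    forall A : set R, measurable A ->
      nu A = \int[lebesgue_measure]_(t in A) (c * f t)%:E.

Definition nu_weight (R : realType) (r t : R) : R :=
  if (0 < t < 1)%R then
    (t `^ (1 / (r - 1)) *
       expR (- (1 / (1 - t `^ (r / (r - 1))) `^ (r - 1))))%R
  else 0%R.

(* The family is indexed from 0, so that M k stands for M_{k+1}: the sum over
   j >= 1 of q * M_1 * ... * M_{j-1}. *)
Definition perpetuity (R : realType) (d : measure_display)
    (T : measurableType d) (P : probability T R) (q : R)
    (M : nat -> {RV P >-> R}) (w : T) : \bar R :=
  \sum_(0 <= j <oo) (q * \prod_(k < j) M k w)%:E.

(* [lne 0 = -oo], whereas the real-valued [ln] is 0 at 0. *)
Definition log_tail_ratio (R : realType) (d : measure_display)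
    (T : measurableType d) (P : probability T R) (X : {RV P >-> R})
    (r q x : R) : \bar R :=
  lne (P [set w | (x <= X w)%R]) / ((x / q) `^ r)%:E.

Lemma limn_measurable (R : realType) (d : measure_display)
    (T : measurableType d) (f : nat -> T -> \bar R) :
  (forall n, measurable_fun setT (f n)) ->
  measurable_fun setT (fun w => limn (f ^~ w)).
Proof.
move=> mf.
have msup : measurable_fun setT (fun w => limn_esup (f ^~ w)).
  exact: measurable_fun_limn_esup.
have minf : measurable_fun setT (fun w => limn_einf (f ^~ w)).
  rewrite (_ : (fun w => _) =
      (fun w => - limn_esup ((fun n w => - f n w) ^~ w))).
    apply: measurableT_comp => //.
    by apply: measurable_fun_limn_esup => n; exact: measurableT_comp.
  apply/funext => w; rewrite -[RHS]limn_einfN.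
  by congr limn_einf; apply/funext => n /=; rewrite oppeK.
rewrite (_ : (fun w => _) = (fun w =>
    if limn_einf (f ^~ w) == limn_esup (f ^~ w)
    then limn_esup (f ^~ w) else point)); last first.
  apply/funext => w; case: ifPn => [/eqP e|ne].
    apply/cvg_lim => //.
    apply: (@squeeze_cvge _ _ _ _ (einfs (f ^~ w)) _ (esups (f ^~ w))).
    - apply: nearW => n; apply/andP; split.
        by apply: ereal_inf_lbound; exists n => /=.
      by apply: ereal_sup_ubound; exists n => /=.
    - rewrite -e limn_einf_lim; apply: is_cvg_einfs.
    - rewrite limn_esup_lim; apply: is_cvg_esups.
  apply: dvgP => /cvg_limn_einf_sup[e1 e2].
  by move: ne; rewrite e1 e2 eqxx.
apply: measurable_fun_if => //.
- exact: measurable_fun_eqe.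
- exact: measurable_funTS.
Qed.

Lemma measurable_perpetuity (R : realType) (d : measure_display)
    (T : measurableType d) (P : probability T R) (q : R)
    (M : nat -> {RV P >-> R}) :
  measurable_fun setT (perpetuity q M).
Proof.
apply: limn_measurable => n.
apply: emeasurable_sum => j; apply/measurable_EFinP.
apply: measurable_funM => //.
by apply: measurable_prod => k _; exact: measurable_funPT.
Qed.

(* Main.v *)
(* Write s = r - 1 and p e = P (M > 1 - e). Elementary bounds on the density give
   exp (- A / e ^ s) <~ p e <~ exp (- a / e ^ s) as e -> 0.

   Lower bound: if the first n ~ 2 y factors all exceed 1 - 1 / (6 y), the first n
   terms of the series already add up to q y; this has probability at least
   p (1 / (6 y)) ^ n, which is exp (- O (y ^ r)).

   Upper bound: put F n = P (R >= q n). In R = q + M R' with R >= q (n + 1), either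
   M > 1 - 2 / n and R' >= q n, or R' >= q (n + 2). Hence
   F (n + 1) <= p (2 / n) F n + F (n + 2), which telescopes (F -> 0 because R is
   finite) to F (n + 1) <= F n \sum_(k >= n) p (2 / k) <= C exp (- b n ^ s) F n;
   multiplying n such ratios gives F (2 n) <= exp (- c n ^ r). *)

Require Import Defs.
From HB Require Import structures.
From mathcomp Require Import all_boot all_order all_algebra.
From mathcomp Require Import all_classical all_reals all_analysis.
From mathcomp Require Import measurable_realfun.
From mathcomp Require Import ring lra.

Set Implicit Arguments.
Unset Strict Implicit.
Unset Printing Implicit Defensive.

Import Order.TTheory GRing.Theory Num.Theory.
Import numFieldNormedType.Exports.

Local Open Scope classical_set_scope.
Local Open Scope ring_scope.

(** * Elementary inequalities for powers and exponentials *)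

Lemma natr_ge (R : archiRealDomainType) (x : R) : exists2 n : nat, 0 < n%:R :> R & x <= n%:R.
Proof.
exists (Num.bound `|x|).+1 => //; apply: (le_trans (ler_norm _)).
by apply: (le_trans (ltW (archi_boundP (normr_ge0 _)))); rewrite ler_nat.
Qed.

(** Raise u <= exp u, with u = a x^s / N and N >= p / s, to the power N. This lets exponentials
    absorb polynomial factors. *)
Lemma powR_le_expR (R : realType) (a s p : R) : 0 < a -> 0 < s ->
  exists2 C : R, 0 < C & forall x, 1 <= x -> x `^ p <= C * expR (a * x `^ s).
Proof.
move=> a0 s0; have [N N0 psN] := natr_ge (p / s).
have pN : p <= s * N%:R by rewrite mulrC -ler_pdivrMr.
exists ((N%:R / a) ^+ N) => [|x x1]; first by rewrite exprn_gt0// divr_gt0.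
have x0 : 0 < x by exact: lt_le_trans x1.
apply: (le_trans (ler_powR x1 pN)).
rewrite powRrM powR_mulrn ?powR_ge0//.
have -> : a * x `^ s = N%:R * (a * x `^ s / N%:R) by field; rewrite gt_eqF.
rewrite expRM_natl -exprMn lerXn2r ?nnegrE ?powR_ge0//.
  by rewrite mulr_ge0 ?expR_ge0// divr_ge0// ltW.
apply: (@le_trans _ _ (N%:R / a * (a * x `^ s / N%:R))).
  by rewrite le_eqVlt; apply/orP; left; apply/eqP; field; rewrite !gt_eqF.
rewrite ler_pM2l ?divr_gt0//.
by apply: le_trans (expR_ge1Dx _); rewrite lerDr.
Qed.

Lemma bernoulli_ineq (R : realDomainType) (x : R) n :
  0 <= x <= 1 -> 1 - n%:R * x <= (1 - x) ^+ n.
Proof.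
move=> /andP[x0 x1]; elim: n => [|n IH]; first by rewrite mul0r subr0.
rewrite exprS -natr1; have y0 : 0 <= 1 - x by rewrite subr_ge0.
apply: le_trans (ler_wpM2l y0 IH); rewrite -subr_ge0.
have -> : (1 - x) * (1 - n%:R * x) - (1 - (n%:R + 1) * x) = n%:R * (x * x) by ring.
by rewrite mulr_ge0// mulr_ge0.
Qed.

(** On (0, 1), t^b is at least t^N for a natural N >= b, and for the exponent N the bound is
    Bernoulli's inequality at 1 - t. *)
Lemma powR_near1_ub (R : realType) (b : R) :
  exists2 K : R, 0 < K & forall t, 0 < t < 1 -> 1 - t `^ b <= K * (1 - t).
Proof.
have [N N0 bN] := natr_ge b.
exists N%:R => // t /andP[t0 t1].
have : t `^ N%:R <= t `^ b by apply: ger_powR => //; rewrite t0 ltW.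
rewrite powR_mulrn ?(ltW t0)// => h.
have := @bernoulli_ineq R (1 - t) N; rewrite subKr; lra.
Qed.

(** * The density and the tails near 1 *)

Lemma measurable_nu_weight (R : realType) (r : R) :
  measurable_fun [set: R] (nu_weight r).
Proof.
apply: measurable_fun_ifT => //=.
  by apply: measurable_and; apply: measurable_fun_ltr.
apply: measurable_funM => //; apply: measurableT_comp => //.
apply: measurableT_comp => //.
under eq_fun do rewrite div1r -powRN.
by apply: (measurableT_comp (measurable_powR _)); apply: measurable_funB.
Qed.

Lemma nu_weight_ge0 (R : realType) (r t : R) : 0 <= nu_weight r t.
Proof. by rewrite /nu_weight; case: ifP => // _; rewrite mulr_ge0 ?powR_ge0 ?expR_ge0. Qed.

(** The power factor is at most 1, and [powR_near1_ub] gives 1 - t^(r/(r-1)) <= K (1 - t) <= K e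
    inside the exponential; hence a = K^(-(r-1)). *)
Lemma nu_weight_ub (R : realType) (r : R) : 1 < r ->
  exists2 a : R, 0 < a & forall e t, 0 < e <= 1 -> 1 - e < t ->
    nu_weight r t <= expR (- (a * (e^-1) `^ (r - 1))).
Proof.
move=> r1; have s0 : 0 < r - 1 by rewrite subr_gt0.
have [K K0 hK] := powR_near1_ub (r / (r - 1)).
exists ((K `^ (r - 1))^-1) => [|e t /andP[e0 e1] te].
  by rewrite invr_gt0 powR_gt0.
rewrite /nu_weight; case: ifPn => [/andP[t0 t1]|_]; last exact: expR_ge0.
rewrite -[leRHS]mul1r ler_pM ?powR_ge0 ?expR_ge0//.
  rewrite -[leRHS](powRr0 t); apply: ger_powR; first by rewrite t0 ltW.
  by rewrite divr_ge0// ltW.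
rewrite ler_expR lerN2 div1r.
have u0 : 0 < 1 - t `^ (r / (r - 1)).
  have : t `^ (r / (r - 1)) < 1 `^ (r / (r - 1)); last by rewrite powR1 subr_gt0.
  by apply: gt0_ltr_powR; rewrite ?nnegrE ?(ltW t0)// divr_gt0//; lra.
have -> : (K `^ (r - 1))^-1 * e^-1 `^ (r - 1) = ((K * e) `^ (r - 1))^-1.
  by rewrite powRM ?(ltW K0) ?(ltW e0)// invfM -[e^-1]powR_inv1 ?(ltW e0)// powRAC powR_inv1 ?powR_ge0.
rewrite lef_pV2 ?posrE ?powR_gt0 ?mulr_gt0//.
apply: ge0_ler_powR; rewrite ?nnegrE ?(ltW s0) ?(ltW u0) ?mulr_ge0 ?(ltW K0) ?(ltW e0)//.
apply: le_trans (hK _ _) _; first by rewrite t0.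
by rewrite ler_pM2l//; lra.
Qed.

(** Since r/(r-1) >= 1, t^(r/(r-1)) <= t <= 1 - e, which controls the exponential; t >= 1/2 keeps
    the power factor away from 0. *)
Lemma nu_weight_lb (R : realType) (r : R) : 1 < r ->
  exists2 k : R, 0 < k & forall e t, 0 < e -> 2^-1 <= t -> t < 1 -> t <= 1 - e ->
    k * expR (- ((e^-1) `^ (r - 1))) <= nu_weight r t.
Proof.
move=> r1; have s0 : 0 < r - 1 by rewrite subr_gt0.
exists (2^-1 `^ (1 / (r - 1))) => [|e t e0 t2 t1 te].
  by rewrite powR_gt0// invr_gt0.
have t0 : 0 < t by lra.
rewrite /nu_weight t0 t1/=.
rewrite ler_pM ?powR_ge0 ?expR_ge0//.
  by apply: ge0_ler_powR; rewrite ?nnegrE ?invr_ge0 ?(ltW t0)// divr_ge0// ltW.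
rewrite ler_expR lerN2 div1r.
have hu : e <= 1 - t `^ (r / (r - 1)).
  have : t `^ (r / (r - 1)) <= t; last by lra.
  apply: ge1r_powR; first by rewrite t0 ltW.
  by rewrite ler_pdivlMr//; lra.
rewrite -[e^-1]powR_inv1 ?(ltW e0)// powRAC powR_inv1 ?powR_ge0//.
rewrite lef_pV2 ?posrE ?powR_gt0//; last by lra.
by apply: ge0_ler_powR; rewrite ?nnegrE ?(ltW s0) ?(ltW e0)//; lra.
Qed.

(** For the upper bound, [nu_weight_ub] is integrated over an interval of length e <= 1. For the
    lower bound, only the part (1 - e, 1 - e/2] is kept, where [nu_weight_lb] applies at scale
    e/2. *)
Lemma nu_tail (R : realType) (r : R) (nu : probability (measurableTypeR R) R) :
  1 < r -> has_density_proportional_to nu (nu_weight r) ->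
  exists a A k K : R, [/\ 0 < a, 0 < A, 0 < k, 0 < K &
    forall e : R, 0 < e <= 2^-1 ->
     ((k * expR (- (A * e^-1 `^ (r - 1))))%:E <= nu `](1 - e)%R, 1%R]%classic <=
      (K * expR (- (a * e^-1 `^ (r - 1))))%:E)%E].
Proof.
move=> r1 [c c0 nuE]; have s0 : 0 < r - 1 by rewrite subr_gt0.
have [a a0 ha] := nu_weight_ub r1; have [k k0 hk] := nu_weight_lb r1.
have [C C0 hC] := @powR_le_expR R 1 (r - 1) 1 ltr01 s0.
have mw D : measurable D -> measurable_fun D (fun t => (c * nu_weight r t)%:E).
  move=> mD; apply/measurable_EFinP; apply: measurable_funM => //.
  by apply: measurable_funTS; apply: measurable_nu_weight.
(* In the second constant, 2^(r-1) comes from the scale e/2, and the 1 pays for the length e/2 of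
   the interval through 1/e <= C exp(e^(-(r-1))). *)
exists a, (1 + 2 `^ (r - 1)), (c * k * (2 * C)^-1), c; split => //.
- by rewrite !(mulr_gt0, invr_gt0).
move=> e /andP[e0 e2]; rewrite nuE//; apply/andP; split.
- have le1 : lebesgue_measure `](1 - e)%R, (1 - e / 2)%R] = (e / 2)%:E :> \bar R.
    rewrite lebesgue_measure_itv/= lte_fin ifT; last by lra.
    by rewrite -EFinB; congr EFin; lra.
  apply: (@le_trans _ _ (\int[lebesgue_measure]_(t in `](1 - e)%R, (1 - e / 2)%R]%classic) (c * nu_weight r t)%:E)%E); last first.
    apply: ge0_subset_integral => //.
    - exact: mw.
    - by move=> x _; rewrite lee_fin mulr_ge0 ?nu_weight_ge0// ltW.
    - by apply: subset_itvl; rewrite bnd_simp; lra.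
  apply: (@le_trans _ _ (\int[lebesgue_measure]_(t in `](1 - e)%R, (1 - e / 2)%R]%classic) cst ((c * (k * expR (- ((e / 2)^-1 `^ (r - 1)))))%:E) t)%E).
    rewrite integral_cst// [X in (_ <= _ * X)%E]le1 -EFinM lee_fin.
    have -> : (1 + 2 `^ (r - 1)) * e^-1 `^ (r - 1) = e^-1 `^ (r - 1) + (e / 2)^-1 `^ (r - 1).
      by rewrite mulrDl mul1r invf_div powRM// invr_ge0 ltW.
    have := hC e^-1; rewrite invf_ge1// powRr1 ?invr_ge0 ?(ltW e0)// mul1r => h.
    have {}h : (C * expR (e^-1 `^ (r - 1)))^-1 <= e.
      rewrite -[leRHS]invrK lef_pV2 ?posrE ?invr_gt0 ?mulr_gt0 ?expR_gt0//.
      by apply: h; lra.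
    rewrite opprD expRD.
    rewrite (_ : c * k / (2 * C) * _ = c * (k * expR (- (e / 2)^-1 `^ (r - 1))) *
        ((C * expR (e^-1 `^ (r - 1)))^-1 / 2)); last first.
      by rewrite (expRN (e^-1 `^ _)); field; rewrite !gt_eqF ?expR_gt0.
    rewrite ler_pM2l ?mulr_gt0 ?expR_gt0//.
    by rewrite ler_pM2r.
  apply: ge0_le_integral => //.
  - by move=> x _; rewrite lee_fin !mulr_ge0 ?expR_ge0// ltW.
  - exact: mw.
  - move=> x /=; rewrite in_itv/= => /andP[x1 x2].
    by rewrite lee_fin ler_pM2l// hk//; lra.
- apply: (@le_trans _ _ (\int[lebesgue_measure]_(t in `](1 - e)%R, 1%R]%classic) cst ((c * (expR (- (a * (e^-1 `^ (r - 1))))))%:E) t)%E).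
    apply: ge0_le_integral => //.
    + by move=> x _; rewrite lee_fin mulr_ge0 ?nu_weight_ge0// ltW.
    + exact: mw.
    + move=> x /=; rewrite in_itv/= => /andP[x1 x2].
      by rewrite lee_fin ler_pM2l// ha//; lra.
  rewrite integral_cst//= lebesgue_measure_itv/= lte_fin ifT; last by lra.
  rewrite -EFinB -EFinM lee_fin ler_piMr//; last by lra.
  by rewrite mulr_ge0 ?expR_ge0// ltW.
Qed.

Lemma tail_equivalent_at_1 (R : realType) (r : R)
    (nu : probability (measurableTypeR R) R) (mu : set R -> \bar R) :
  1 < r -> has_density_proportional_to nu (nu_weight r) ->
  equivalent_at_1 mu nu ->
  exists eps a A k K : R, [/\ 0 < eps <= 2^-1, 0 < a, 0 < A, 0 < k < 1 & 0 < K] /\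
    forall e : R, 0 < e <= eps ->
     ((k * expR (- (A * e^-1 `^ (r - 1))))%:E <= mu `](1 - e)%R, 1%R]%classic <=
      (K * expR (- (a * e^-1 `^ (r - 1))))%:E)%E.
Proof.
move=> r1 nuE [eps [d [D [/andP[eps0 eps1] /andP[d0 dD] h]]]].
have [a [A [k [K [a0 A0 k0 K0 tl]]]]] := nu_tail r1 nuE.
(* Dividing d k by 1 + d k brings the constant below 1, so that its logarithm is negative in
   [perpetuity_tail_ge]. *)
have kk1 : 0 < d * k / (1 + d * k) < 1.
  have dk0 : 0 < d * k by exact: mulr_gt0.
  by rewrite divr_gt0 ?addr_gt0//= ltr_pdivrMr ?addr_gt0//; lra.
exists (Num.min eps 2^-1), a, A, (d * k / (1 + d * k)), (D * K); split.
  split=> //; last by rewrite mulr_gt0// (lt_trans d0).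
  by rewrite lt_min eps0 ge_min lexx orbT invr_gt0 ltr0n.
move=> e /andP[e0]; rewrite le_min => /andP[e1 e2].
have [v nuIE] : exists v, nu `](1 - e)%R, 1%R]%classic = v%:E.
  by exists (fine (nu `](1 - e)%R, 1%R]%classic)); rewrite fineK ?fin_num_measure.
have := h e; rewrite e0 e1 => /(_ isT)/=; rewrite nuIE.
have := tl e; rewrite e0 e2 => /(_ isT)/=; rewrite nuIE !lee_fin => /andP[v1 v2].
have v0 : 0 < v by apply: lt_le_trans v1; rewrite mulr_gt0// expR_gt0.
(* As [v] is finite and positive, the extended quotient is a genuine one and the denominator can be
   cleared. *)
rewrite inver gt_eqF// lee_pdivlMr// lee_pdivrMr// -!EFinM => /andP[m1 m2].
apply/andP; split.
  apply: le_trans m1; rewrite lee_fin.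
  apply: (@le_trans _ _ (d * (k * expR (- (A * e^-1 `^ (r - 1)))))).
    rewrite mulrA ler_pM2r ?expR_gt0// ler_pdivrMr ?addr_gt0 ?mulr_gt0//.
    by rewrite ler_pMr ?mulr_gt0// lerDl ltW// mulr_gt0.
  by rewrite ler_pM2l.
apply: (le_trans m2); rewrite lee_fin -mulrA ler_pM2l//.
exact: lt_trans dD.
Qed.

(** * Super-exponential decay from the recursion *)

(* The recursion telescopes, and [\sum_(k >= n) 1 / k ^ 2 <= 1]. *)
Lemma ratio_bound (R : realType) (F : nat -> R) (Q : R) (n : nat) :
  (1 < n)%N -> 0 <= Q -> (forall k, 0 <= F k) ->
  {homo F : i j / (i <= j)%N >-> j <= i} ->
  (forall e, 0 < e -> exists m, F m <= e) ->
  (forall k, (n <= k)%N -> F k.+1 <= Q / k%:R ^+ 2 * F k + F k.+2) ->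
  F n.+1 <= Q * F n.
Proof.
move=> n1 Q0 F0 Fdec Flim Frec.
(* The bracket bounds the sum of 1/k^2 over n <= k < n + m, because 1/k^2 <= 1/(k-1) - 1/k; n > 1
   keeps n - 1 positive. Each F k in the sum is replaced by F n. *)
have step m : F n.+1 <= Q * F n * (n.-1%:R^-1 - (n + m).-1%:R^-1) + F (n + m).+1.
  elim: m => [|m IH]; first by rewrite addn0 subrr mulr0 add0r.
  apply: (le_trans IH).
  have nmn : (n <= n + m)%N by rewrite leq_addr.
  apply: (le_trans (lerD (lexx _) (Frec _ nmn))); rewrite addrA addnS/=.
  rewrite lerD2r.
  have h1 : Q / (n + m)%:R ^+ 2 * F (n + m)%N <= Q * F n * (n + m)%:R ^- 2.
    rewrite mulrAC ler_wpM2r ?invr_ge0 ?exprn_ge0//.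
    by rewrite ler_wpM2l// Fdec.
  apply: (le_trans (lerD (lexx _) h1)); rewrite -mulrDr.
  rewrite ler_wpM2l ?mulr_ge0//.
  have : (0 < (n + m).-1)%N by case: (n) n1 => [|[|]].
  have -> : (n + m)%:R = (n + m).-1%:R + 1 :> R.
    by rewrite natr1 prednK// addn_gt0 (ltn_trans _ n1).
  move: ((n + m).-1) => l; rewrite -(ltr0n R) => l0.
  rewrite -subr_ge0.
  rewrite (_ : _ - _ = (l%:R * (l%:R + 1) ^+ 2)^-1); last first.
    have nn : 0 < n.-1%:R :> R by rewrite ltr0n; case: (n) n1 => [|[|]].
    by field; rewrite !gt_eqF ?addr_gt0.
  by rewrite invr_ge0 mulr_ge0// ?exprn_ge0// addr_ge0// ltW.
apply/ler_addgt0Pr => e e0; have [m Fm] := Flim e e0.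
apply: (le_trans (step m)); apply: lerD; last first.
  by apply: le_trans Fm; apply: Fdec; rewrite leqW// leq_addl.
rewrite -[leRHS]mulr1 ler_wpM2l ?mulr_ge0//.
rewrite lerBlDr; apply: (@le_trans _ _ 1); last by rewrite lerDl invr_ge0.
rewrite invf_le1 ?ltr0n ?ler1n; by case: (n) n1 => [|[|]].
Qed.

(** Half of the exponent a absorbs the factor k^2 that [ratio_bound] asks for; the other half bounds
    every ratio F (k+1) / F k with k >= n by a multiple of exp(-b n^s). Chaining n such ratios from
    n to 2n turns n^s into n^(s+1). *)
Lemma superexp_decay (R : realType) (F p : nat -> R) (s a K : R) (k0 : nat) :
  0 < s -> 0 < a -> 0 < K -> (forall k, 0 <= F k <= 1) ->
  {homo F : i j / (i <= j)%N >-> j <= i} ->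
  (forall e, 0 < e -> exists m, F m <= e) ->
  (forall k, (k0 <= k)%N -> F k.+1 <= p k * F k + F k.+2) ->
  (forall k, (k0 <= k)%N -> p k <= K * expR (- (a * k%:R `^ s))) ->
  exists2 c : R, 0 < c & exists n0 : nat, forall n : nat, (n0 <= n)%N ->
    F n.*2 <= expR (- (c * n%:R `^ (s + 1))).
Proof.
move=> s0 a0 K0 F01 Fdec Flim Frec ple.
have F0 k : 0 <= F k by case/andP: (F01 k).
have F1 k : F k <= 1 by case/andP: (F01 k).
have [b b0 ab] : exists2 b, 0 < b & a = b + b by exists (a / 2); lra.
have [C C0 hC] := @powR_le_expR R b s 2 b0 s0.
have KC0 : 0 < K * C by rewrite mulr_gt0.
have ratio n : (maxn k0 2 <= n)%N -> forall k, (n <= k)%N ->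
    F k.+1 <= K * C * expR (- (b * n%:R `^ s)) * F k.
  rewrite geq_max => /andP[kn n2] k nk.
  have k1 : (1 < k)%N by exact: leq_trans nk.
  apply: ratio_bound => // [|l kl].
    by rewrite mulr_ge0 ?expR_ge0// ltW.
  have nl : (n <= l)%N by exact: leq_trans kl.
  apply: (le_trans (Frec l (leq_trans kn nl))).
  rewrite lerD2r ler_wpM2r//.
  apply: (le_trans (ple l (leq_trans kn nl))).
  have l0 : 0 < l%:R :> R by rewrite ltr0n (leq_trans _ nl)// ltnW.
  rewrite -!mulrA ler_pM2l// ab.
  rewrite mulrDl opprD expRD mulrCA.
  apply: ler_pM; rewrite ?expR_ge0//.
    rewrite ler_expR lerN2 ler_pM2l//; apply: ge0_ler_powR; rewrite ?nnegrE//.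
      exact: ltW.
    by rewrite ler_nat.
  rewrite expRN ler_pdivlMr ?exprn_gt0// ler_pdivrMl ?expR_gt0// [leRHS]mulrC.
  have := hC l%:R; rewrite powR_mulrn ?(ltW l0)//; apply.
  by rewrite ler1n -(ltr0n R).
(* For n >= N, half of b n^s exceeds ln (K C), so the prefactor disappears. If that logarithm is not
   positive the claim is immediate, and the root is used only in the other case. *)
have [N N0 hN] := natr_ge ((2 * ln (K * C) / b) `^ s^-1).
exists (b / 2); first by rewrite divr_gt0.
exists (maxn (maxn k0 2) N) => n; rewrite geq_max => /andP[n2 nN].
have n0 : 0 < n%:R :> R by rewrite ltr0n (leq_trans _ n2)// leq_max orbT.
have big : K * C * expR (- (b * n%:R `^ s)) <= expR (- (b / 2 * n%:R `^ s)).
  rewrite -[K * C]lnK ?posrE// -expRD ler_expR.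
  suff : 2 * ln (K * C) / b <= n%:R `^ s.
    by rewrite ler_pdivrMr//; lra.
  have [neg|pos] := leP (2 * ln (K * C) / b) 0.
    by rewrite (le_trans neg)// powR_ge0.
  have -> : 2 * ln (K * C) / b = ((2 * ln (K * C) / b) `^ s^-1) `^ s.
    by rewrite -powRrM mulVf ?gt_eqF// powRr1// ltW.
  apply: ge0_ler_powR; rewrite ?nnegrE ?powR_ge0 ?(ltW s0) ?(ltW n0)//.
  by rewrite (le_trans hN)// ler_nat.
have iter m : F (n + m)%N <= expR (- (b / 2 * n%:R `^ s)) ^+ m.
  elim: m => [|m IH]; first by rewrite addn0 expr0.
  rewrite addnS exprS.
  apply: (le_trans (ratio n n2 _ (leq_addr m n))).
  by apply: ler_pM => //; rewrite mulr_ge0 ?expR_ge0// ltW.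
rewrite -addnn (le_trans (iter n))// -expRM_natr ler_expR.
rewrite powRD ?(gt_eqF n0) ?implybT// powRr1 ?(ltW n0)//.
by rewrite le_eqVlt; apply/orP; left; apply/eqP; ring.
Qed.

(** * The sequence space and independence of the first factor from the shifted sequence *)

(** A pi-system generating the product sigma-algebra: boxes that constrain finitely many
    coordinates, whose probabilities are finite products. *)
Definition cylinders (R : realType) : set (set (nat -> R)) :=
  [set S | exists A : nat -> set R, [/\ forall k, measurable (A k),
    exists n, forall k, (n <= k)%N -> A k = setT &
    S = [set x | forall k, A k (x k)]]].

Definition seq_space (R : realType) := g_sigma_algebraType (@cylinders R).

Lemma measurable_to_seq_space (R : realType) (d : measure_display)
    (T : measurableType d) (Y : T -> nat -> R) :
  (forall k, measurable_fun setT (Y ^~ k)) ->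
  measurable_fun setT (Y : T -> seq_space R).
Proof.
move=> mY; apply: (@measurability _ _ T (seq_space R) setT Y (@cylinders R) erefl) => _ [_ [A [mA _ ->]] <-].
rewrite (_ : _ `&` _ = \bigcap_k (Y ^~ k @^-1` A k)).
  by apply: bigcapT_measurable => k; rewrite -[X in measurable X]setTI; exact: mY.
by rewrite setTI; apply/seteqP; split => w /= h k => [_|]; exact: h.
Qed.

Lemma measurable_coordinate (R : realType) (k : nat) :
  measurable_fun setT (fun x : seq_space R => x k).
Proof.
move=> _ B mB; rewrite setTI; apply: sub_sigma_algebra.
exists (fun j => if j == k then B else setT); split.
- by move=> j; case: ifP.
- by exists k.+1 => j; case: eqVneq => // ->; rewrite ltnn.
- apply/seteqP; split => [x /= xB j|x /= /(_ k)]; last by rewrite eqxx.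
  by case: eqVneq => // ->.
Qed.

Lemma setI_closed_cylinders (R : realType) : setI_closed (@cylinders R).
Proof.
move=> _ _ [A [mA [n hA] ->]] [B [mB [m hB] ->]].
exists (fun k => A k `&` B k); split.
- by move=> k; exact: measurableI.
- exists (maxn n m) => k; rewrite geq_max => /andP[nk mk].
  by rewrite hA// hB// setTI.
- apply/seteqP; split => [x [xA xB] k|x /= h]; first by split.
  by split=> k; have [] := h k.
Qed.

Section iid_sequence.
Context (R : realType) (d : measure_display) (T : measurableType d)
  (P : probability T R) (M : nat -> {RV P >-> R}).
Hypothesis M_indep : mutually_independent M.
Hypothesis M_ident : forall k (A : set R), measurable A ->
  P (M k @^-1` A) = P (M 0%N @^-1` A).

Lemma prob_cylinder (A : nat -> set R) (n : nat) :
  (forall k, measurable (A k)) -> (forall k, (n <= k)%N -> A k = setT) ->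
  P [set w | forall k, A k (M k w)] = (\prod_(k < n) P (M 0%N @^-1` A k))%E.
Proof.
move=> mA hA.
rewrite (_ : [set w | _] = \bigcap_(k in [set` iota 0 n]) (M k @^-1` A k)); last first.
  apply/seteqP; split => [w /= h k _|w h k /=]; first exact: h.
  have [nk|kn] := leqP n k; first by rewrite hA.
  by apply: (h k) => /=; rewrite mem_iota.
rewrite M_indep ?iota_uniq// -[in LHS](subn0 n) -/(index_iota 0 n) big_mkord.
by apply: eq_bigr => k _; rewrite M_ident.
Qed.

Lemma indep_shift (B : set R) (S : set (seq_space R)) :
  measurable B -> measurable S ->
  P [set w | B (M 0%N w) /\ S (fun k => M k.+1 w)] =
  (P (M 0%N @^-1` B) * P [set w | S (fun k => M k w)])%E.
Proof.
move=> mB mS.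
have mMB : measurable (M 0%N @^-1` B) by rewrite -[X in measurable X]setTI; exact: measurable_funPT.
have m1f : measurable_fun setT ((fun w k => M k.+1 w) : T -> seq_space R).
  by apply: measurable_to_seq_space => k; exact: measurable_funPT.
have m0f : measurable_fun setT ((fun w k => M k w) : T -> seq_space R).
  by apply: measurable_to_seq_space => k; exact: measurable_funPT.
unshelve epose (m1 := pushforward (mrestr P mMB) ((fun w k => M k.+1 w) : T -> seq_space R)
  : {measure set (seq_space R) -> \bar R}) => //.
have pB0 : 0 <= fine (P (M 0%N @^-1` B)) by exact/fine_ge0/measure_ge0.
unshelve epose (m2 := mscale (NngNum pB0) (pushforward P ((fun w k => M k w) : T -> seq_space R))
  : {measure set (seq_space R) -> \bar R}) => //.
have := @measure_unique _ R (seq_space R) (@cylinders R) (fun _ => setT) erefl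
  (@setI_closed_cylinders R) _ _ m1 m2 _ _ S mS.
rewrite /m1 /m2 /= /mscale /pushforward /mrestr /=.
rewrite fineK ?fin_num_measure// => <-.
- by congr (P _); apply/seteqP; split => w /= [].
- by move=> _; exists (fun _ => setT); split => //; [exists 0%N|apply/seteqP; split].
- by rewrite bigcup_const.
- move=> _ [A [mA [n hA] ->]].
  (* Prepending B to the sides of the cylinder gives a cylinder of length n + 1, whose first factor
     is the scalar in [m2]. *)
  have := @prob_cylinder (fun k => if k is j.+1 then A j else B) n.+1.
  rewrite big_ord_recl/= -(prob_cylinder mA hA) => <-.
  + congr (P _); apply/seteqP; split => [w /= [h hB] [|k]//|w /= h].
    by split; [move=> k; exact: (h k.+1)|exact: (h 0%N)].
  + by case.
  + by case=> // k; rewrite ltnS => /hA.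
- move=> _; rewrite preimage_setT setTI ltey_eq fin_num_measure//.
Qed.

End iid_sequence.

(** * Pathwise estimates for the perpetuity *)

(** The perpetuity as a function on the sequence space, so that it can be evaluated at the shifted
    sequence of factors too. *)
Definition perp_sum (R : realType) (q : R) (x : nat -> R) : \bar R :=
  (\sum_(0 <= j <oo) (q * \prod_(k < j) x k)%:E)%E.

Lemma measurable_perp_sum (R : realType) (q : R) :
  measurable_fun setT (perp_sum q : seq_space R -> \bar R).
Proof.
apply: limn_measurable => n.
apply: emeasurable_sum => j; apply/measurable_EFinP.
apply: measurable_funM => //.
by apply: measurable_prod => k _; exact: measurable_coordinate.
Qed.

Lemma perp_sum_ge0 (R : realType) (q : R) (x : nat -> R) :
  0 <= q -> (forall k, 0 <= x k) -> (0 <= perp_sum q x)%E.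
Proof.
by move=> q0 x0; apply: nneseries_ge0 => n _ _; rewrite lee_fin mulr_ge0 ?prodr_ge0.
Qed.

Lemma perp_sum_rec (R : realType) (q : R) (x : nat -> R) :
  0 <= q -> (forall k, 0 <= x k) ->
  perp_sum q x = (q%:E + (x 0%N)%:E * perp_sum q (fun k => x k.+1))%E.
Proof.
move=> q0 x0; rewrite {1}/perp_sum nneseries_recl//; last first.
  by move=> k _; rewrite lee_fin mulr_ge0 ?prodr_ge0.
rewrite big_ord0 mulr1; congr (_ + _)%E.
rewrite /perp_sum -nneseriesZl; last by move=> k _; rewrite lee_fin mulr_ge0 ?prodr_ge0.
rewrite -(@nneseries_addn R (fun j => (q * \prod_(k < j) x k)%:E) 1%N); last first.
  by move=> k; rewrite lee_fin mulr_ge0 ?prodr_ge0.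
apply: eq_eseriesr => j _; rewrite addn1 -EFinM big_ord_recl; congr EFin.
by rewrite mulrCA.
Qed.

(* If the first factor is at most [1 - e], the tail of the series must make up
   for the lost proportion [e]; if it is not, we only use that it is at most 1. *)
Lemma perp_sum_step (R : realType) (q e : R) (n : nat) (x : nat -> R) :
  0 < q -> (forall k, 0 <= x k <= 1) -> n%:R * e = 2 -> e < 1 ->
  ((q * n.+1%:R)%:E <= perp_sum q x)%E ->
  (x 0%N \in `](1 - e), 1] /\ ((q * n%:R)%:E <= perp_sum q (fun k => x k.+1))%E) \/
  ((q * n.+2%:R)%:E <= perp_sum q (fun k => x k.+1))%E.
Proof.
move=> q0 x01 ne e1; have x0 k : 0 <= x k by case/andP: (x01 k).
rewrite perp_sum_rec ?(ltW q0)//.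
have := @perp_sum_ge0 _ q (fun k => x k.+1) (ltW q0) (fun k => x0 k.+1).
case: perp_sum => [y| |]//; last by move=> _ _; right; rewrite leey.
rewrite -EFinM -EFinD !lee_fin => y0 h.
have e0 : 0 < e.
  rewrite ltNge; apply/negP => e0.
  by have := mulr_ge0_le0 (ler0n R n) e0; rewrite ne; lra.
have {}h : q * n%:R <= x 0%N * y by move: h; rewrite -natr1 mulrDr mulr1; lra.
have [x0e|x0e] := ltP (1 - e) (x 0%N).
  left; rewrite in_itv/= x0e; case/andP: (x01 0%N) => _ x01'; split=> //.
  by apply: (le_trans h); rewrite ler_piMl.
right.
have h2 : q * n%:R <= (1 - e) * y by rewrite (le_trans h)// ler_wpM2r.
have : (1 - e) * (q * n.+2%:R) <= (1 - e) * y; last by rewrite ler_pM2l// subr_gt0.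
apply: le_trans h2.
rewrite -[n.+2]addn2 natrD mulrCA ler_pM2l//.
(* The choice n e = 2 is made here: it gives (1 - e)(n + 2) = n - 2 e <= n. *)
have -> : (1 - e) * (n%:R + 2) = n%:R + 2 - n%:R * e - 2 * e by ring.
by rewrite ne; lra.
Qed.

(* On the event that every factor exceeds [1 - e], Bernoulli's inequality bounds
   the first [n] terms of the series from below. *)
Lemma perp_sum_lb (R : realType) (q e : R) (n : nat) (x : nat -> R) :
  0 < q -> 0 <= e <= 1 -> (forall k, 0 <= x k) ->
  (forall k, (k < n)%N -> 1 - e <= x k) ->
  ((q * n%:R * (1 - n%:R * e))%:E <= perp_sum q x)%E.
Proof.
move=> q0 /andP[e0 e1] x0 xe.
apply: (@le_trans _ _ (\sum_(0 <= j < n) (q * \prod_(k < j) x k)%:E)%E); last first.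
  by apply: nneseries_lim_ge => k _ _; rewrite lee_fin mulr_ge0 ?prodr_ge0 ?(ltW q0).
rewrite sumEFin lee_fin -mulr_sumr -mulrA ler_pM2l//.
rewrite [leLHS](_ : _ = \sum_(0 <= j < n) (1 - n%:R * e)); last first.
  by rewrite sumr_const_nat subn0 mulr_natl.
apply: ler_sum_nat => j /andP[_ jn].
apply: (@le_trans _ _ ((1 - e) ^+ j)).
  apply: (@le_trans _ _ (1 - j%:R * e)); last by apply: bernoulli_ineq; rewrite e0.
  by rewrite lerB// ler_wpM2r// ler_nat ltnW.
rewrite -[j in _ ^+ j]card_ord -prodr_const; apply: ler_prod => k _.
by rewrite subr_ge0 e1 xe// (ltn_trans _ jn).
Qed.

(** * Tail bounds for the perpetuity *)

Section perpetuity_tail.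
Context (R : realType) (d : measure_display) (T : measurableType d)
  (P : probability T R) (M : nat -> {RV P >-> R}) (q : R).
Hypothesis M_indep : mutually_independent M.
Hypothesis M_ident : forall k (A : set R), measurable A ->
  P (M k @^-1` A) = P (M 0%N @^-1` A).
Hypothesis M01 : P (M 0%N @^-1` `[0, 1]) = 1%E.
Hypothesis q_gt0 : 0 < q.

Let X (w : T) := perp_sum q (fun k => M k w).
Let S (w : T) := perp_sum q (fun k => M k.+1 w).
(* The factors lie in [0, 1] only almost surely; [N] is the exceptional set. *)
Let N : set T := \bigcup_k (M k @^-1` ~` `[0, 1]).

Let mX : measurable_fun setT X.
Proof.
apply: (measurableT_comp (@measurable_perp_sum R q)).
by apply: measurable_to_seq_space => k; exact: measurable_funPT.
Qed.

Let mS : measurable_fun setT S.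
Proof.
apply: (measurableT_comp (@measurable_perp_sum R q)).
by apply: measurable_to_seq_space => k; exact: measurable_funPT.
Qed.

Let mM k (A : set R) : measurable A -> measurable (M k @^-1` A).
Proof. by move=> mA; rewrite -[X in measurable X]setTI; exact: measurable_funPT. Qed.

Let mge (Y : T -> \bar R) (y : R) : measurable_fun setT Y -> measurable [set w | (y%:E <= Y w)%E].
Proof.
move=> mY; rewrite -[X in measurable X]setTI; apply: emeasurable_fun_c_infty => //.
Qed.

Let mN : measurable N.
Proof. by apply: bigcup_measurable => k _; apply: mM; exact: measurableC. Qed.

Let PN : P N = 0%E.
Proof.
apply: measure_negligible => //; apply: negligible_bigcup => k.
apply/negligibleP; first by apply: mM; exact: measurableC.
transitivity (P (M 0%N @^-1` (~` `[0, 1]))).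
  by apply: M_ident; exact: measurableC.
rewrite preimage_setC probability_setC; last exact: (mM 0 (measurable_itv `[0, 1])).
by rewrite [X in (_ - X)%E]M01 subee.
Qed.

Let notN w : ~ N w -> forall k, 0 <= M k w <= 1.
Proof.
move=> h k; apply: contrapT => hk; by apply: h; exists k.
Qed.

(** A union bound over the two alternatives of [perp_sum_step], valid off the null set [N];
    [indep_shift] factors the first one. *)
Lemma perpetuity_tail_rec (e : R) (n : nat) : n%:R * e = 2 -> e < 1 ->
  (P [set w | (q * n.+1%:R)%:E <= X w] <=
   P (M 0%N @^-1` `](1 - e)%R, 1%R]%classic) * P [set w | (q * n%:R)%:E <= X w]
   + P [set w | (q * n.+2%:R)%:E <= X w])%E.
Proof.
move=> ne e1.
have indep B y : measurable B ->
    P [set w | B (M 0%N w) /\ (y%:E <= S w)%E] = (P (M 0%N @^-1` B) * P [set w | y%:E <= X w])%E.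
  move=> mB; rewrite -(indep_shift M_indep M_ident (S := [set x | (y%:E <= perp_sum q x)%E]))//.
  rewrite -[X in measurable X]setTI; apply: emeasurable_fun_c_infty => //.
  exact: measurable_perp_sum.
rewrite -indep; last exact: measurable_itv.
(* With B = setT, independence says that the shifted series [S] has the tails of [X]. *)
have -> : P [set w | ((q * n.+2%:R)%:E <= X w)%E] = P [set w | setT (M 0%N w) /\ ((q * n.+2%:R)%:E <= S w)%E].
  by rewrite indep// preimage_setT probability_setT mul1e.
have m1 : measurable [set w | `](1 - e)%R, 1%R]%classic (M 0%N w) /\ ((q * n%:R)%:E <= S w)%E].
  by apply: measurableI; [apply: mM|apply: mge].
have m2 : measurable [set w | setT (M 0%N w) /\ ((q * n.+2%:R)%:E <= S w)%E].
  by apply: measurableI; [apply: mM|apply: mge].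
apply: le_trans (measureU2 P m1 m2).
rewrite -[leRHS]add0e -[in leRHS]PN.
apply: le_trans (measureU2 P mN (measurableU _ _ m1 m2)).
apply: le_measure; rewrite ?inE//; first exact: mge.
  by apply: measurableU => //; exact: measurableU.
move=> w /= h; have [Nw|/notN M01w] := pselect (N w); first by left.
by right; have [[]|] := perp_sum_step q_gt0 M01w ne e1 h; [left|right].
Qed.

(** The event that the first n factors exceed 1 - e is a cylinder, and off [N] it forces the sum up
    by [perp_sum_lb]. *)
Lemma perpetuity_tail_lb (e : R) (n : nat) : 0 <= e <= 1 ->
  ((fine (P (M 0%N @^-1` `](1 - e)%R, 1%R]%classic)) ^+ n)%:E <=
   P [set w | (q * n%:R * (1 - n%:R * e))%:E <= X w])%E.
Proof.
move=> e01.
pose A k : set R := if (k < n)%N then `](1 - e)%R, 1%R]%classic else setT.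
have mA k : measurable (A k) by rewrite /A; case: ifP.
have := prob_cylinder M_indep M_ident mA (n := n) _.
rewrite (eq_bigr (fun _ => (fine (P (M 0%N @^-1` `](1 - e)%R, 1%R]%classic)))%:E)); last first.
  by move=> k _; rewrite /A ltn_ord fineK// fin_num_measure//; exact: mM.
rewrite prodEFin prodr_const card_ord => <-; last first.
  by move=> k nk; rewrite /A ltnNge nk.
rewrite -[leRHS]add0e -[in leRHS]PN.
have mXn := mge (q * n%:R * (1 - n%:R * e)) mX.
apply: le_trans (measureU2 P mN mXn).
apply: le_measure; rewrite ?inE//.
- rewrite (_ : mkset _ = \bigcap_k (M k @^-1` A k)).
    by apply: bigcapT_measurable => k; exact: mM.
  by apply/seteqP; split => w /= h k => [_|]; exact: h.
- exact: measurableU.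
move=> w /= h; have [Nw|/notN M01w] := pselect (N w); first by left.
right; apply: perp_sum_lb => // k; first by case/andP: (M01w k).
by move=> kn; have := h k; rewrite /A kn/= in_itv/= => /andP[/ltW].
Qed.

Lemma perpetuity_tail_ge (eps A k s : R) : 0 < eps <= 1 -> 0 < A -> 0 < k < 1 -> 0 < s ->
  (forall e, 0 < e <= eps -> ((k * expR (- (A * e^-1 `^ s)))%:E <=
     P (M 0%N @^-1` `](1 - e)%R, 1%R]%classic))%E) ->
  exists c y0 : R, forall y, y0 <= y ->
    ((expR (c * y `^ (s + 1)))%:E <= P [set w | (q * y)%:E <= X w])%E.
Proof.
move=> /andP[eps0 eps1] A0 /andP[k0 k1] s0 tail.
(* The 3 comes from n <= 3 y and the 6 from 1/e = 6 y; y >= 1 allows - ln k to be multiplied by y^s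
   and gives 2 y + 1 <= 3 y, while y >= 1/eps gives e <= eps. *)
exists (- (3 * (- ln k + A * 6 `^ s))), (Num.max 1 eps^-1) => y.
rewrite ge_max => /andP[y1 yeps]; have y0 : 0 < y by exact: lt_le_trans y1.
pose e := (6 * y)^-1; have e0 : 0 < e by rewrite invr_gt0 mulr_gt0.
have eeps : e <= eps.
  rewrite -[leRHS]invrK lef_pV2 ?posrE ?mulr_gt0 ?invr_gt0//.
  by apply: (le_trans yeps); lra.
pose n := (Num.trunc (2 * y)).+1.
have /andP[n1 n2] : 2 * y <= n%:R <= 3 * y.
  have y20 : 0 <= 2 * y by lra.
  by have := truncn_itv y20; rewrite /n -natr1; lra.
apply: (@le_trans _ _ (P [set w | ((q * n%:R * (1 - n%:R * e))%:E <= X w)%E])); last first.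
  apply: le_measure; rewrite ?inE//; try exact: mge.
  move=> w /=; apply: le_trans; rewrite lee_fin -mulrA ler_pM2l//.
  have ne : n%:R * e <= 2^-1.
    by rewrite /e ler_pdivrMr ?mulr_gt0//; lra.
  apply: (@le_trans _ _ (2 * y * 2^-1)); first by lra.
  by apply: ler_pM; lra.
apply: le_trans (perpetuity_tail_lb n _); last first.
  by rewrite (ltW e0) (le_trans eeps).
have := tail e; rewrite e0 eeps => /(_ isT).
set p := P _; have pf : p \is a fin_num by apply: fin_num_measure; exact: mM.
rewrite -[X in (_ <= X)%E]fineK// lee_fin => pe; rewrite lee_fin.
have le0 : 0 <= k * expR (- (A * e^-1 `^ s)) by rewrite mulr_ge0 ?expR_ge0// ltW.
have := lerXn2r n le0 (le_trans le0 pe) pe; apply: le_trans.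
have kE : k = expR (ln k) by rewrite lnK ?posrE.
have lk : 0 < - ln k by rewrite oppr_gt0 ln_lt0// k0.
rewrite [in leRHS]kE -expRD -expRM_natr ler_expR /e invrK powRM ?(ltW y0)//.
have ys1 : 1 <= y `^ s by rewrite -[leLHS](powRr0 y) ler_powR// ltW.
rewrite powRD ?(gt_eqF y0) ?implybT// powRr1 ?(ltW y0)//.
have A6 : 0 < A * 6 `^ s by rewrite mulr_gt0// powR_gt0.
rewrite -lerN2 -mulNr opprD !opprK mulNr opprK.
apply: (@le_trans _ _ ((- ln k + A * 6 `^ s) * y `^ s * (3 * y))); last first.
  by rewrite le_eqVlt; apply/orP; left; apply/eqP; ring.
apply: ler_pM => //.
  by rewrite addr_ge0 ?mulr_ge0 ?powR_ge0 ?(ltW lk)// ltW.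
rewrite mulrDl mulrA lerD2r ler_peMr//; exact: ltW.
Qed.

Lemma perpetuity_tail_le (eps a K s : R) : 0 < eps <= 2^-1 -> 0 < a -> 0 < K -> 0 < s ->
  (forall e, 0 < e <= eps -> (P (M 0%N @^-1` `](1 - e)%R, 1%R]%classic) <=
     (K * expR (- (a * e^-1 `^ s)))%:E)%E) ->
  (forall e, 0 < e -> exists n : nat, (P [set w | (q * n%:R)%:E <= X w] <= e%:E)%E) ->
  exists c y0 : R, 0 < c /\ forall y, y0 <= y ->
    (P [set w | (q * y)%:E <= X w] <= (expR (- (c * y `^ (s + 1))))%:E)%E.
Proof.
move=> /andP[eps0 eps2] a0 K0 s0 tail to0.
have [k0 k00 hk0] := natr_ge (2 / eps).
pose F n := fine (P [set w | ((q * n%:R)%:E <= X w)%E]).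
pose p k := fine (P (M 0%N @^-1` `](1 - 2 / k%:R)%R, 1%R]%classic)).
have FE n : (F n)%:E = P [set w | ((q * n%:R)%:E <= X w)%E].
  by rewrite /F fineK// fin_num_measure//; exact: mge.
have pE k : (p k)%:E = P (M 0%N @^-1` `](1 - 2 / k%:R)%R, 1%R]%classic).
  by rewrite /p fineK// fin_num_measure//; exact: mM.
have small k : (k0 <= k)%N -> 0 < 2 / k%:R :> R /\ 2 / k%:R <= eps.
  rewrite -(ler_nat R) => k0k; have kpos : 0 < k%:R :> R by exact: lt_le_trans k0k.
  split; first exact: divr_gt0.
  by rewrite ler_pdivrMr// mulrC -ler_pdivrMr// (le_trans hk0).
(* With e = 2/k one has 1/e = k/2, whence the rate a 2^(-s); k0 >= 2/eps ensures e <= eps. *)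
have [||||||c c0 [n0 hc]] := @superexp_decay R F p s (a * 2 `^ (- s)) K k0 s0 _ K0.
- by rewrite mulr_gt0// powR_gt0.
- move=> k; rewrite -!lee_fin FE measure_ge0/= probability_le1//; exact: mge.
- move=> i j ij; rewrite -lee_fin !FE; apply: le_measure; rewrite ?inE//; try exact: mge.
  by move=> w /=; apply: le_trans; rewrite lee_fin ler_pM2l// ler_nat.
- by move=> e /to0[n hn]; exists n; rewrite -lee_fin FE.
- move=> k /small[e0 e1].
  have kpos : 0 < k%:R :> R by move: e0; rewrite pmulr_rgt0// invr_gt0.
  rewrite -lee_fin EFinD EFinM !FE pE.
  apply: perpetuity_tail_rec; first by field; rewrite gt_eqF.
  by lra.
- move=> k /small /andP e01; rewrite -lee_fin pE; apply: le_trans (tail _ e01) _.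
  by rewrite invf_div powRM// ?invr_ge0// -[2^-1]powR_inv1// -powRrM mulN1r -mulrA [X in a * X]mulrC.
(* Rounding: for y >= 4 the integer part n of y/2 satisfies y/4 <= n and 2 n <= y, so F (2 n)
   dominates the tail at y at the cost of 4^(s+1) in the rate. The bound y >= 4 n0 gives n >= n0. *)
exists (c * (4 `^ (s + 1))^-1), (Num.max 4 (4 * n0%:R)); split.
  by rewrite mulr_gt0// invr_gt0 powR_gt0.
move=> y; rewrite ge_max => /andP[y4 yn0].
pose n := Num.trunc (y / 2).
have /andP[n1 n2] : y / 4 <= n%:R <= y / 2.
  have y20 : 0 <= y / 2 by lra.
  by have := truncn_itv y20; rewrite /n -[(Num.trunc _).+1%:R]natr1; lra.
apply: (@le_trans _ _ (F n.*2)%:E).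
  rewrite FE; apply: le_measure; rewrite ?inE//; try exact: mge.
  move=> w /=; apply: le_trans; rewrite lee_fin ler_pM2l//.
  by rewrite -muln2 natrM; lra.
rewrite lee_fin; apply: (le_trans (hc n _)).
  by rewrite -(ler_nat R); lra.
rewrite ler_expR lerN2 -mulrA ler_pM2l//.
rewrite -(powR_inv1 (powR_ge0 _ _)) -powRAC powR_inv1// -powRM ?invr_ge0//; last by lra.
by apply: ge0_ler_powR; rewrite ?nnegrE; lra.
Qed.

End perpetuity_tail.

(** * Passage to the limit and conclusion *)

(** Any two neighbourhoods of +oo share a point x, and f x separates the infimum over one from the
    supremum over the other. *)
Lemma limf_einf_le_esup (R : realType) (f : R -> \bar R) :
  (limf_einf f +oo%R <= limf_esup f +oo%R)%E.
Proof.
rewrite limf_einfE limf_esupE; apply: ge_ereal_sup => _ [V V_oo <-].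
apply: le_ereal_inf_tmp => _ [W W_oo <-].
have [x [Vx Wx]] := @filter_ex _ _ (@proper_pinfty_nbhs R) _ (filterI V_oo W_oo).
apply: (@le_trans _ _ (f x)).
  by apply: ereal_inf_lbound; exists x.
by apply: ereal_sup_ubound; exists x.
Qed.

Theorem theorem6 (R : realType) (r q : R) (r_gt1 : 1 < r) (q_gt0 : 0 < q)
    (nu : probability (measurableTypeR R) R)
    (nu_density : has_density_proportional_to nu (nu_weight r))
    (d : measure_display) (T : measurableType d) (P : probability T R)
    (M : {RV P >-> R}) (M01 : forall w, 0 <= M w <= 1)
    (M_equiv : equivalent_at_1 (distribution P M) nu)
    (d' : measure_display) (T' : measurableType d') (P' : probability T' R)
    (M_ : nat -> {RV P' >-> R}) (M_indep : mutually_independent M_)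
    (M_copy : forall k, equal_in_law P' (M_ k) P M)
    (d'' : measure_display) (T'' : measurableType d'') (P'' : probability T'' R)
    (X : {RV P'' >-> R})
    (X_law : equal_in_law P'' (fun w => (X w)%:E) P' (perpetuity q M_)) :
  exists c1 c2 : R,
    [/\ (c1%:E <= limf_einf (log_tail_ratio X r q) +oo%R)%E,
        (limf_einf (log_tail_ratio X r q) +oo%R <=
           limf_esup (log_tail_ratio X r q) +oo%R)%E,
        (limf_esup (log_tail_ratio X r q) +oo%R <= c2%:E)%E &
        c2 < 0].
Proof.
have s0 : 0 < r - 1 by rewrite subr_gt0.
have [eps [a [A [k [K [[eps01 a0 A0 k01 K0] tail]]]]]] :=
  tail_equivalent_at_1 r_gt1 nu_density M_equiv.
have lawM B : measurable B -> P' (M_ 0%N @^-1` B) = distribution P M B.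
  exact: (M_copy 0%N).
have M_ident j (B : set R) : measurable B -> P' (M_ j @^-1` B) = P' (M_ 0%N @^-1` B).
  by move=> mB; rewrite lawM//; exact: (M_copy j).
have M_01 : P' (M_ 0%N @^-1` `[0, 1]) = 1%E.
  rewrite lawM// /distribution /pushforward -(@probability_setT _ _ _ P).
  by congr (P _); apply/seteqP; split => // w _ /=; rewrite in_itv/=.
have lawX y : P'' [set w | (y <= X w)%R] = P' [set w | (y%:E <= perp_sum q (fun k => M_ k w))%E].
  have := X_law [set z | (y%:E <= z)%E]; rewrite /pushforward /= => <-.
    by congr (P'' _); apply/seteqP; split => w /=; rewrite lee_fin.
  by rewrite -[X in measurable X]setTI; apply: emeasurable_fun_c_infty.
have XE y : P'' [set w | (q * y <= X w)%R] =
    P' [set w | ((q * y)%:E <= perp_sum q (fun k => M_ k w))%E] by exact: lawX.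
have mX B : measurable B -> measurable (X @^-1` B).
  by move=> mB; rewrite -[X in measurable X]setTI; exact: measurable_funPT.
have mXy y : measurable [set w | (q * y <= X w)%R].
  rewrite (_ : [set w | _] = X @^-1` `[q * y, +oo[).
    exact: mX.
  by apply/seteqP; split => w /=; rewrite in_itv/= andbT.
have eps1 : 0 < eps <= 1 by case/andP: eps01 => ? ?; lra.
have [|c1 [y1 hc1]] := perpetuity_tail_ge M_indep M_ident M_01 q_gt0 eps1 A0 k01 s0.
  by move=> e /tail /andP[+ _]; rewrite lawM.
have [||c2 [y2 [c20 hc2]]] := perpetuity_tail_le M_indep M_ident M_01 q_gt0 eps01 a0 K0 s0.
- by move=> e /tail /andP[_]; rewrite lawM.
(* Finiteness of the perpetuity enters here: it has the law of the real-valued [X], whose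
   complementary distribution function tends to 0. *)
- move=> e e0; have nbhs_e : nbhs (0 : \bar R)%E [set z | (z < e%:E)%E].
    apply: open_nbhs_nbhs; split; first exact: open_ereal_lt_ereal.
    by rewrite /= lte_fin.
  have /pinfty_ex_gt0[x0 x00 /= hx0] := cvg_ccdfy0 X nbhs_e.
  (* The extra 1 yields q n > x0, since [ccdf] is the probability of a strict inequality. *)
  have [n n0 hn] := natr_ge ((x0 + 1) / q); exists n.
  rewrite -XE; apply/ltW; apply: le_lt_trans hx0.
  apply: le_measure; rewrite ?inE; [exact: mXy|exact: mX|].
  move=> w /= hw; rewrite in_itv/= andbT.
  by move: hn; rewrite ler_pdivrMr// mulrC; lra.
have ratioE x : 0 < x -> let y := x / q in
    [/\ 0 < y `^ r, q * y = x & log_tail_ratio X r q x =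
      (lne (P'' [set w | (q * y <= X w)%R]) * ((y `^ r)^-1)%:E)%E].
  move=> x0 y; have y0 : 0 < y by rewrite divr_gt0.
  have qy : q * y = x by rewrite mulrC divfK// gt_eqF.
  by split; rewrite ?powR_gt0// /log_tail_ratio qy inver gt_eqF// powR_gt0.
have exp01 z : (expR z)%:E \in `[0%E, +oo%E] by rewrite in_itv/= lee_fin expR_ge0 leey.
have P01 B : measurable B -> P'' B \in `[0%E, +oo%E] by move=> mB; rewrite in_itv/= measure_ge0 leey.
exists c1, (- c2); split.
(* The liminf is a supremum of infima over neighbourhoods of +oo, so the half-line where x > 0 and x
   / q >= y1 suffices; the limsup is treated dually. *)
- rewrite limf_einfE; apply: le_ereal_sup_tmp.
  exists (ereal_inf (log_tail_ratio X r q @` [set x | Num.max 1 (y1 * q) <= x])).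
    exists [set x | Num.max 1 (y1 * q) <= x] => //.
    by apply: nbhs_pinfty_ge; exact: num_real.
  apply: le_ereal_inf_tmp => _ [x /= + <-]; rewrite ge_max => /andP[x1 xy1].
  have x0 : 0 < x by exact: lt_le_trans x1.
  have [yr0 qy ->] := ratioE x x0.
  rewrite lee_pdivlMr// -EFinM.
  have -> : (c1 * (x / q) `^ r)%:E = lne (expR (c1 * (x / q) `^ r))%:E.
    by rewrite lne_EFin ?expR_gt0// expRK.
  rewrite lee_lne; [|exact: exp01|exact: P01].
  by rewrite XE -[in leLHS](subrK 1 r); apply: hc1; rewrite ler_pdivlMr.
- exact: limf_einf_le_esup.
- rewrite limf_esupE; apply: ge_ereal_inf.
  exists (ereal_sup (log_tail_ratio X r q @` [set x | Num.max 1 (y2 * q) <= x])).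
    exists [set x | Num.max 1 (y2 * q) <= x] => //.
    by apply: nbhs_pinfty_ge; exact: num_real.
  apply: ge_ereal_sup => _ [x /= + <-]; rewrite ge_max => /andP[x1 xy2].
  have x0 : 0 < x by exact: lt_le_trans x1.
  have [yr0 qy ->] := ratioE x x0.
  rewrite lee_pdivrMr// -EFinM.
  have -> : (- c2 * (x / q) `^ r)%:E = lne (expR (- c2 * (x / q) `^ r))%:E.
    by rewrite lne_EFin ?expR_gt0// expRK.
  rewrite lee_lne; [|exact: P01|exact: exp01].
  by rewrite XE mulNr -[in leRHS](subrK 1 r); apply: hc2; rewrite ler_pdivlMr.
- by rewrite oppr_lt0.
Qed.
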